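(* Let $(T,X,\pi)$ be a minimal topologically weakly-mixing flow on a non-singleton compact metric space $X$, where $T$ is an abelian topological group. Then $(T,X,\pi)$ is densely multi-dimensional Li-Yorke chaotic.
   Context: A topological flow $(T,X,\pi)$ consists of a topological group $T$ (not necessarily discrete), a topological space $X$ and a jointly continuous action $\pi\colon T\times X\to X$, $(t,x)\mapsto tx$, with $s(tx)=(st)x$ and $ex=x$, where $e$ is the neutral element. $T$ acts on $X^k$ by $t(x_1,\dots,x_k)=(tx_1,\dots,tx_k)$. The flow is minimal if $\overline{\{tx : t\in T\}}=X$ for every $x\in X$. For nonempty open $U,V\subseteq X$ let $N_T(U,V)=\{t\in T : U\cap t^{-1}V\neq\emptyset\}$, $t^{-1}V=\{x : tx\in V\}$. The flow is topologically weakly-mixing if $N_T(U,V)\cap N_T(U',V')\neq\emptyset$ for all nonempty open $U,V,U',V'\subseteq X$ (equivalently, $(T,X\times X)$ is topologically transitive). $(T,X,\pi)$ is densely multi-dimensional Li-Yorke chaotic if for every increasing sequence $\{F_n\}_{n\ge1}$ of compact subsets of $T$ there is an uncountable dense set $\Theta\subseteq X$ such that for any $k\ge2$ and any distinct $x_1,\dots,x_k\in\Theta$ there are sequences $\{s_n\},\{t_n\}$ in $T$ and a point $p\in X$ with $s_n\notin F_n$ for all $n$, $s_n(x_1,\dots,x_k)\to(x_1,\dots,x_k)$ and $t_n(x_1,\dots,x_k)\to(p,\dots,p)$ as $n\to\infty$. *)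

(* Defs.v *)
From mathcomp Require Import all_boot all_order all_algebra.
From mathcomp Require Import all_classical all_reals all_analysis.

Set Implicit Arguments.
Unset Strict Implicit.
Unset Printing Implicit Defensive.

Import GRing.Theory.

Local Open Scope classical_set_scope.
Local Open Scope ring_scope.

(* Flows of an abelian topological group: [topologicalZmodType] is the library's
   (not necessarily Hausdorff) abelian topological group, written additively, so
   the product [st] is [s + t] and the neutral element is [0]. *)
Record flow (T : topologicalZmodType) (X : topologicalType) := Flow {
  flow_act :> T -> X -> X;
  flow_act0 : forall x, flow_act 0 x = x;
  flow_actD : forall s t x, flow_act s (flow_act t x) = flow_act (s + t) x;
  flow_act_continuous : continuous (fun p : T * X => flow_act p.1 p.2)
}.

Section FlowDefs.
Context {T : topologicalZmodType} {X : topologicalType}.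
Implicit Types (a : flow T X) (U V : set X).

Definition minimal_flow a : Prop :=
  forall x : X, closure (range (a ^~ x)) = [set: X].

Definition hitting_times a U V : set T :=
  [set t | U `&` (a t @^-1` V) !=set0].

Definition weakly_mixing a : Prop :=
  forall U V U' V' : set X,
    open U -> U !=set0 -> open V -> V !=set0 ->
    open U' -> U' !=set0 -> open V' -> V' !=set0 ->
    hitting_times a U V `&` hitting_times a U' V' !=set0.

(* [{ptws 'I_k -> X}] is X^k with the product topology. *)
Definition diag_act a (k : nat) (t : T) (x : {ptws 'I_k -> X}) :
  {ptws 'I_k -> X} := fun i => a t (x i).

Definition densely_multidim_Li_Yorke_chaotic a : Prop :=
  forall F : nat -> set T,
    (forall n, compact (F n)) ->
    {homo F : m n / (m <= n)%N >-> m `<=` n} ->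
    exists Theta : set X,
      [/\ ~ countable Theta, dense Theta &
        forall (k : nat) (x : {ptws 'I_k -> X}), (2 <= k)%N ->
          injective x -> (forall i, Theta (x i)) ->
          exists (s t : nat -> T) (p : X),
            [/\ forall n, ~ F n (s n),
                diag_act a (s n) x @[n --> \oo] --> x &
                diag_act a (t n) x @[n --> \oo] -->
                  ((fun=> p) : {ptws 'I_k -> X})]].

End FlowDefs.

(* Main.v *)
From HB Require Import structures.
Require Import Defs.
From mathcomp Require Import all_boot all_order all_algebra.
From mathcomp Require Import all_classical all_reals all_analysis.

(** Furstenberg's intersection lemma (hitting_times_directed) says that, for an
    abelian group, the sets of hitting times of a weakly mixing flow are directed
    downwards, so that they generate a filter on the group. This filter contains
    no compact set K (hitting_times_exit_compact): it would have a cluster point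
    t0 in K, but near t0 the group elements send a small neighborhood of a point
    x close to the translate of x by t0, hence away from some other open set.

    Call a set A freely movable if any finitely many points of A can be sent into
    arbitrarily prescribed nonempty open sets, one for each point, by a single
    group element, which moreover can be taken in any set of hitting times and
    outside any F n. Sending each point back near itself gives the recurrence and
    sending all of them near one point gives the asymptotic collapse, so a dense
    uncountable freely movable set is what has to be found.

    - The empty set is freely movable: that is what the first paragraph says.
    - A countable freely movable set A can be extended by a new point. For fixed
      finite data, the points x that can be moved together with the chosen points
      of A form an open set. It is dense: at the times that hit the target of x
      from an open set N, some point of N goes to that target, and by the
      intersection lemma there is a set of hitting times consisting of such times
      that are also among the prescribed ones; A can be moved within it. This is
      why hitting times are part of the definition. Baire's theorem gives a
      common x for the countably many data that matter.
    - Hence a maximal freely movable set, given by Zorn's lemma, is uncountable.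
    - Translating each point of a freely movable set by a group element of its
      own keeps it freely movable, since the group is abelian. By minimality, the
      members of an infinite sequence in the set can thus be placed one in each
      member of a countable pi-base, which makes the set dense. *)

Set Implicit Arguments.
Unset Strict Implicit.
Unset Printing Implicit Defensive.

Import Order.TTheory GRing.Theory Num.Theory.

Local Open Scope classical_set_scope.

(** * Topological preliminaries *)

Lemma hausdorff_disjoint_opens (X : topologicalType) (x y : X) :
  hausdorff_space X -> x <> y -> exists U V : set X,
    [/\ open U, U x, open V, V y & forall z, U z -> ~ V z].
Proof.
rewrite open_hausdorff => sepX /eqP /sepX[[U V] /= [/set_mem Ux /set_mem Vy]].
move=> [oU oV /eqP UV0]; exists U, V; split=> // z Uz Vz.
by have : (U `&` V) z by []; rewrite UV0.
Qed.

(** The usual nested construction; compactness provides the limit point as a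
    cluster point of the filter generated by the nested open sets. *)
Lemma compact_hausdorff_Baire (X : topologicalType) (D : nat -> set X) :
  compact [set: X] -> hausdorff_space X ->
  (forall n, open (D n) /\ dense (D n)) -> dense (\bigcap_n D n).
Proof.
move=> cptX sepX odD O O0 oO.
pose P (V : set X) := open V /\ V !=set0.
have shrink (nV : nat * {V | P V}) : exists W : {V | P V},
    closure (sval W) `<=` sval nV.2 `&` D nV.1.
  case: nV => n [V [oV V0]] /=.
  have [oDn dDn] := odD n; have [x VDx] := dDn V V0 oV.
  have VDn : nbhs x (V `&` D n).
    by apply: open_nbhs_nbhs; split => //; exact: openI.
  have [W Wx WVD] := compact_regular sepX cptX filterT VDn.
  have PW : P W^° by split; [exact: open_interior|exists x].
  exists (exist P _ PW) => /=; apply: subset_trans WVD.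
  by apply: closureS; exact: interior_subset.
have [f fP] := choice shrink.
pose V := fix V n := if n is m.+1 then f (m, V m) else exist P O (conj oO O0).
have VS n : closure (sval (V n.+1)) `<=` sval (V n) `&` D n by exact: fP (n, V n).
have Vle m n : (m <= n)%N -> sval (V n) `<=` sval (V m).
  elim: n => [|n IHn]; first by rewrite leqn0 => /eqP ->.
  rewrite leq_eqVlt => /predU1P[->//|/IHn]; apply: subset_trans => x Vx.
  by have [] := VS n x (subset_closure Vx).
have FV : ProperFilter (filter_from [set: nat] (fun n => sval (V n))).
  apply: filter_from_proper => [|n _]; last by case: (svalP (V n)).
  apply: filter_from_filter => [|m n _ _]; first by exists 0%N.
  exists (maxn m n) => // x Vx.
  by split; apply: Vle Vx; [exact: leq_maxl|exact: leq_maxr].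
have [x [_ Vx]] := cptX _ FV (filterT (F := filter_from _ _)).
have clV n : closure (sval (V n)) x by move=> B /Vx; apply; exists n.
by exists x; split=> [|n _]; [case: (VS _ _ (clV 1%N))|case: (VS _ _ (clV n.+1))].
Qed.

(** A countable family of nonempty open sets that is coarser than a basis: it
    need only put a member inside every nonempty open set, which is all that the
    category argument and the density of the chaotic set ask for. *)
Definition pi_base (X : topologicalType) (B : nat -> set X) : Prop :=
  (forall n, open (B n) /\ B n !=set0) /\
  forall V, open V -> V !=set0 -> exists n, B n `<=` V.

Lemma compact_metric_pi_base (R : realType) (X : metricType R) (x0 : X) :
  compact [set: X] ->
  exists B : nat -> set X, pi_base B.
Proof.
move=> cptX.
pose Xp : pseudoPMetricType R := HB.pack X (isPointed.Build X x0).
have [C Ccount [Copen Cbase]] := @compact_second_countable R Xp cptX.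
have /countable_injP[g ginj] : countable [set V : set X | C V /\ V !=set0].
  by apply: sub_countable Ccount; apply: subset_card_le => V [].
have pick n : exists V : set X, (open V /\ V !=set0) /\
    forall W : set X, C W -> W !=set0 -> g W = n -> V = W.
  have [[W [[CW W0] gW]]|noW] := pselect (exists W, (C W /\ W !=set0) /\ g W = n).
    exists W; split; first by split; [exact: Copen|].
    by move=> W' CW' W'0 gW'; apply: ginj; rewrite ?inE // gW.
  exists setT; split; first by split; [exact: openT|exists x0].
  by move=> W CW W0 gW; case: noW; exists W.
have [B BP] := choice pick; exists B; split=> [n|V oV [x Vx]].
  by have [] := BP n.
have [W [CW Wx] WV] := Cbase x V (open_nbhs_nbhs (conj oV Vx)).
by exists (g W); rewrite ((BP (g W)).2 W CW (ex_intro _ x Wx) erefl).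
Qed.

(** * Hitting times of a weakly mixing abelian flow *)

Section Flow.
Context (T : topologicalZmodType).

Lemma flow_comm (X : topologicalType) (a : flow T X) s t x :
  a s (a t x) = a t (a s x).
Proof. by rewrite !flow_actD addrC. Qed.

Lemma flow_actK (X : topologicalType) (a : flow T X) t x :
  a t (a (- t)%R x) = x.
Proof. by rewrite flow_actD subrr flow_act0. Qed.

Lemma continuous_flow_act (X : topologicalType) (a : flow T X) t : continuous (a t).
Proof.
move=> x; apply: (@continuous_comp _ _ _ (fun x => (t, x)) (fun p => a p.1 p.2)).
  by apply: cvg_pair => /=; [exact: cvg_cst|exact: cvg_id].
exact: flow_act_continuous.
Qed.

Lemma open_preimage_flow_act (X : topologicalType) (a : flow T X) t U :
  open U -> open (a t @^-1` U).
Proof. by apply: open_comp => x _; exact: continuous_flow_act. Qed.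

Lemma hitting_times_sub (X : topologicalType) (a : flow T X)
    (U U' V V' : set X) :
  U `<=` U' -> V `<=` V' -> hitting_times a U V `<=` hitting_times a U' V'.
Proof.
by move=> UU' VV' t [x [Ux Vx]]; exists x; split; [exact: UU'|exact: VV'].
Qed.

(** If s moves some point of U into U' and some point of V into V', then a time
    that moves U `&` a s @^-1` U' to V `&` a s @^-1` V' moves U to V, and after
    applying s, which commutes with it, U' to V'. *)
Lemma hitting_times_directed (X : topologicalType) (a : flow T X) U V U' V' :
  weakly_mixing a ->
  open U -> U !=set0 -> open V -> V !=set0 ->
  open U' -> U' !=set0 -> open V' -> V' !=set0 ->
  exists P Q, [/\ open P, P !=set0, open Q, Q !=set0 &
    hitting_times a P Q `<=` hitting_times a U V `&` hitting_times a U' V'].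
Proof.
move=> wma oU U0 oV V0 oU' U'0 oV' V'0.
have [s [[x [Ux U'x]] [y [Vy V'y]]]] := wma U U' V V' oU U0 oU' U'0 oV V0 oV' V'0.
exists (U `&` a s @^-1` U'), (V `&` a s @^-1` V'); split.
- by apply: openI => //; exact: open_preimage_flow_act.
- by exists x.
- by apply: openI => //; exact: open_preimage_flow_act.
- by exists y.
move=> t [z [[Uz U'z] [Vz V'z]]]; split; first by exists z.
by exists (a s z); split=> //=; rewrite flow_comm.
Qed.

(** Otherwise the filter of hitting times would have a cluster point t0 in K.
    Joint continuity at (t0, x1) keeps P, a small neighborhood of x1, inside a
    neighborhood A of a t0 x1 during a neighborhood W of t0, so that W contains
    no time hitting from P an open set B disjoint from A. *)
Lemma hitting_times_exit_compact (X : topologicalType) (a : flow T X) U V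
    (K : set T) :
  hausdorff_space X -> (exists x y : X, x <> y) -> weakly_mixing a ->
  open U -> U !=set0 -> open V -> V !=set0 -> compact K ->
  exists2 t, hitting_times a U V t & ~ K t.
Proof.
move=> sepX [x1 [x2 x12]] wma oU U0 oV V0 cptK.
apply: contrapT => UVK.
have {}UVK : hitting_times a U V `<=` K.
  by move=> t UVt; apply: contrapT => Kt; apply: UVK; exists t.
pose D := [set PQ : set X * set X |
  [/\ open PQ.1, PQ.1 !=set0, open PQ.2 & PQ.2 !=set0]].
pose G := filter_from D (fun PQ => hitting_times a PQ.1 PQ.2).
have DUV : D (U, V) by [].
have GP : ProperFilter G.
  apply: filter_from_proper => [|[P Q] [oP P0 oQ Q0]]; last first.
    by have [t []] := wma P Q P Q oP P0 oQ Q0 oP P0 oQ Q0; exists t.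
  apply: filter_from_filter; first by exists (U, V).
  move=> [P Q] [P' Q'] [oP P0 oQ Q0] [oP' P'0 oQ' Q'0].
  have [A [B [oA A0 oB B0 AB]]] :=
    hitting_times_directed wma oP P0 oQ Q0 oP' P'0 oQ' Q'0.
  by exists (A, B).
have [t0 [_ Gt0]] : K `&` cluster G !=set0 by apply: cptK; exists (U, V).
have [y yt0] : exists y, a t0 x1 <> y.
  have [t0x1|] := pselect (a t0 x1 = x1); first by exists x2; rewrite t0x1.
  by exists x1.
have [A [B [oA Ax1 oB By AB]]] := hausdorff_disjoint_opens sepX yt0.
have [[W P] /= [Wt0 Px1] WPA] := @flow_act_continuous _ _ a (t0, x1) A
  (open_nbhs_nbhs (conj oA Ax1)).
have GPB : G (hitting_times a P^° B).
  exists (P^°, B) => //; split=> //=; first exact: open_interior.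
    by exists x1.
  by exists y.
have [t [[z [Pz Bz]] Wt]] := Gt0 _ _ GPB Wt0.
exact: AB (WPA (t, z) (conj Wt (interior_subset Pz))) Bz.
Qed.

End Flow.

(** * Freely movable sets *)

Section FreelyMovable.
Context (T : topologicalZmodType) (X : topologicalType) (a : flow T X).
Context (F : nat -> set T).

(** The targets U are indexed by points rather than by positions in s, so that
    repetitions in s are harmless and no target is prescribed twice. *)
Definition freely_movable (A : set X) : Prop :=
  forall (s : seq X) (U : X -> set X) (V W : set X) (n : nat),
    (forall x, x \in s -> A x) -> (forall x, open (U x) /\ U x !=set0) ->
    open V -> V !=set0 -> open W -> W !=set0 ->
    exists t, [/\ hitting_times a V W t, ~ F n t &
      forall x, x \in s -> U x (a t x)].

(** Only finitely many points are moved at a time, and these lie in a single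
    member of the chain. For the empty chain the union is empty, whence the first
    hypothesis. *)
Lemma freely_movable_bigcup (C : set (set X)) :
  freely_movable set0 -> C `<=` freely_movable -> total_on C subset ->
  freely_movable (\bigcup_(A in C) A).
Proof.
move=> fm0 fmC totC s U V W n sC.
suff [A fmA sA] : exists2 A, freely_movable A & forall x, x \in s -> A x.
  exact: fmA sA.
have [CN0|C0] := pselect (C !=set0); last first.
  exists set0 => // x /sC[A CA]; by case: C0; exists A.
suff [A CA sA] : exists2 A, C A & forall x, x \in s -> A x.
  by exists A => //; exact: fmC.
elim: s sC => [_|x s IHs sC]; first by case: CN0 => A CA; exists A.
have [A CA sA] : exists2 A, C A & forall x, x \in s -> A x.
  by apply: IHs => y ys; apply: sC; rewrite inE ys orbT.
have [B CB Bx] := sC x (mem_head x s).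
have [AB|BA] := totC A B CA CB.
  by exists B => // y; rewrite inE => /predU1P[->//|/sA/AB].
by exists A => // y; rewrite inE => /predU1P[->|/sA//]; exact: BA.
Qed.

(** Moving the translate of x into U amounts to moving x into the preimage of U
    under the translation, because the translation commutes with the motion. *)
Lemma freely_movable_translate (A : set X) (tau : X -> T) :
  freely_movable A -> freely_movable [set a (tau x) x | x in A].
Proof.
move=> fmA s U V W n sA oU oV V0 oW W0.
have /choice[g gP] (y : X) : exists x, y \in s -> A x /\ a (tau x) x = y.
  have [/sA[x Ax xy]|ys] := boolP (y \in s); first by exists x.
  by exists y => ys'; case/negP: ys.
pose U' x := a (tau x) @^-1` U (a (tau x) x).
have oU' x : open (U' x) /\ U' x !=set0.
  have [oUx [y Uy]] := oU (a (tau x) x).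
  split; first exact: open_preimage_flow_act.
  by exists (a (- tau x)%R y); rewrite /U' /= flow_actK.
have [_ /mapP[y ys ->]|t [VWt Ft Ut]] :=
    fmA (map g s) U' V W n _ oU' oV V0 oW W0.
  by have [] := gP y ys.
exists t; split=> // y ys; have [_ gy] := gP y ys.
by have := Ut (g y) (map_f g ys); rewrite /U' /= flow_comm gy.
Qed.

(** If two distinct points had a common translate, moving them into the preimages
    of disjoint open sets would put this common translate into both. *)
Lemma translate_inj (A : set X) (tau : X -> T) :
  hausdorff_space X -> (exists x y : X, x <> y) -> freely_movable A ->
  {in A &, injective (fun x => a (tau x) x)}.
Proof.
move=> sepX [x1 [x2 x12]] fmA x y /set_mem Ax /set_mem Ay xy.
apply: contrapT => /eqP nxy.
have [V [W [oV Vx oW Wy VW]]] := hausdorff_disjoint_opens sepX x12.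
pose U z := a (tau z) @^-1` (if z == x then V else W).
have oU z : open (U z) /\ U z !=set0.
  have [oVW [w VWw]] : open (if z == x then V else W) /\
      (if z == x then V else W) !=set0.
    by case: ifP => _; split=> //; [exists x1|exists x2].
  split; first exact: open_preimage_flow_act.
  by exists (a (- tau z)%R w); rewrite /U /= flow_actK.
have T0 : [set: X] !=set0 by exists x1.
have [z|t [_ _ Ut]] := fmA [:: x; y] U setT setT 0%N _ oU openT T0 openT T0.
  by rewrite !inE => /predU1P[->|/eqP->].
have := Ut x (mem_head _ _); rewrite /U /= eqxx flow_comm xy => Vt.
have := Ut y; rewrite !inE eqxx orbT /U /= eq_sym (negbTE nxy) flow_comm.
by move=> /(_ isT); exact: VW.
Qed.

Lemma freely_movable0 :
  hausdorff_space X -> (exists x y : X, x <> y) -> weakly_mixing a ->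
  (forall n, compact (F n)) -> freely_movable set0.
Proof.
move=> sepX X2 wma cptF s U V W n s0 _ oV V0 oW W0.
have [t VWt Ft] :=
  hitting_times_exit_compact sepX X2 wma oV V0 oW W0 (cptF n).
by exists t; split=> // x /s0.
Qed.

(** The Baire category step. Up to shrinking the open sets to members of the
    pi-base B, there are countably many requirements, each coded by a finite list
    of pairs (code of a point of A, target), a target for x, a pair of open sets
    for the hitting times, and n. *)
Lemma freely_movable_generic (B : nat -> set X) (A : set X) (x0 : X) :
  compact [set: X] -> hausdorff_space X -> weakly_mixing a ->
  pi_base B ->
  countable A -> freely_movable A ->
  exists x, forall (s : seq X) (U : X -> set X) (O V W : set X) (n : nat),
    (forall y, y \in s -> A y) -> (forall y, open (U y) /\ U y !=set0) ->
    open O -> O !=set0 -> open V -> V !=set0 -> open W -> W !=set0 ->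
    exists t, [/\ hitting_times a V W t, ~ F n t,
      forall y, y \in s -> U y (a t y) & O (a t x)].
Proof.
move=> cptX sepX wma [oB Bpi] /countable_injP[c cinj] fmA.
(* c codes the points of A by natural numbers, and e decodes them. *)
have /choice[e eP] (k : nat) : exists y, forall z, A z -> c z = k -> y = z.
  have [[z [Az zk]]|noz] := pselect (exists z, A z /\ c z = k); last first.
    by exists x0 => z Az zk; case: noz; exists z.
  by exists z => z' Az' z'k; apply: cinj; rewrite ?inE // zk.
pose index := (seq (nat * nat) * nat * (nat * nat) * nat)%type.
pose D (i : index) := let: (u, o, (v, w), n) := i in
  \bigcup_(t in [set t | [/\ hitting_times a (B v) (B w) t, ~ F n t &
    forall p, p \in u -> B p.2 (a t (e p.1))]]) (a t @^-1` B o).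
have oD i : open (D i).
  case: i => [[[u o] [v w]] n]; apply: bigcup_open => t _.
  by apply: open_preimage_flow_act; case: (oB o).
(* A code may prescribe incompatible targets for one point, and then D i need
   not be dense; such codes are discarded by replacing the set by the full space. *)
pose D' k := if unpickle k is Some i
  then (if `[< dense (D i) >] then D i else setT) else setT.
have denseT : dense [set: X] by move=> O [x Ox] _; exists x.
have oD' k : open (D' k) /\ dense (D' k).
  rewrite /D'; case: (unpickle k : option index) => [i|]; last first.
    by split=> //; exact: openT.
  by case: asboolP => // _; split=> //; exact: openT.
have [|x [_ Dx]] := compact_hausdorff_Baire cptX sepX oD' (_ : setT !=set0) openT.
  by exists x0.
exists x => s U O V W n sA oU oO O0 oV V0 oW W0.
have /choice[b bP] (y : X) : exists k, B k `<=` U y by case: (oU y) => *; exact: Bpi.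
have [[m mP] [v vP] [w wP]] := And3 (Bpi O oO O0) (Bpi V oV V0) (Bpi W oW W0).
pose i : index := ([seq (c y, b y) | y <- s], m, (v, w), n).
(* The time moving A is taken among those that also take N to the target of x. *)
have Di : dense (D i).
  move=> N N0 oN.
  have [[oBv Bv0] [oBw Bw0] [oBo Bo0]] := And3 (oB v) (oB w) (oB m).
  have [P [Q [oP' P0 oQ Q0 PQ]]] :=
    hitting_times_directed wma oBv Bv0 oBw Bw0 oN N0 oBo Bo0.
  have [t [/PQ[VWt [z [Nz Oz]]] Ft Ut]] :=
    fmA s (fun y => B (b y)) P Q n sA (fun y => oB (b y)) oP' P0 oQ Q0.
  exists z; split=> //; exists t => //; split=> // _ /mapP[y ys ->] /=.
  by rewrite (eP (c y) y (sA y ys) erefl); exact: Ut.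
have /= := Dx (pickle i) I; rewrite /D' pickleK asboolT //.
move=> [t [VWt Ft Ut] Ox]; exists t; split=> //.
- exact: hitting_times_sub vP wP _ VWt.
- move=> y ys; apply: bP.
  by have := Ut _ (map_f _ ys); rewrite /= (eP (c y) y (sA y ys) erefl).
- exact: mP.
Qed.

(** The generic point x is new: if it were in A, moving it as a point of A and as
    the generic point would send it to two disjoint open sets at once. *)
Lemma freely_movable_extend (B : nat -> set X) (A : set X) :
  compact [set: X] -> hausdorff_space X -> (exists x y : X, x <> y) ->
  weakly_mixing a ->
  pi_base B ->
  countable A -> freely_movable A ->
  exists2 x, ~ A x & freely_movable (x |` A).
Proof.
move=> cptX sepX [x1 [x2 x12]] wma piB cA fmA.
have [x xP] := freely_movable_generic x1 cptX sepX wma piB cA fmA.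
have T0 : [set: X] !=set0 by exists x1.
exists x => [Ax|s U V W n sA oU oV V0 oW W0].
  have [V [W [oV Vx oW Wy VW]]] := hausdorff_disjoint_opens sepX x12.
  have V0 : V !=set0 by exists x1.
  have W0 : W !=set0 by exists x2.
  have [y|t [_ _ Vt Wt]] := xP [:: x] (fun=> V) W setT setT 0%N _
    (fun=> conj oV V0) oW W0 openT T0 openT T0.
    by rewrite inE => /eqP ->.
  exact: VW (Vt x (mem_head _ _)) Wt.
have [oUx Ux0] := oU x.
have [y|t [VWt Ft Ut Uxt]] := xP [seq y <- s | y != x] U (U x) V W n _ oU oUx Ux0
    oV V0 oW W0.
  by rewrite mem_filter => /andP[/eqP yx /sA[]].
exists t; split=> // y ys; have [->//|yx] := eqVneq y x.
by apply: Ut; rewrite mem_filter yx.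
Qed.

Lemma uncountable_freely_movable (B : nat -> set X) :
  compact [set: X] -> hausdorff_space X -> (exists x y : X, x <> y) ->
  weakly_mixing a -> (forall n, compact (F n)) ->
  pi_base B ->
  exists2 A, ~ countable A & freely_movable A.
Proof.
move=> cptX sepX X2 wma cptF piB.
have fm0 := freely_movable0 sepX X2 wma cptF.
have [A [fmA maxA]] := Zorn_bigcup (fun C => freely_movable_bigcup fm0 (C := C)).
exists A => // cA.
have [x Ax fmxA] := freely_movable_extend cptX sepX X2 wma piB cA fmA.
apply: (maxA (x |` A)) fmxA; split; first by move=> y Ay; right.
by move=> /(_ x (or_introl erefl)).
Qed.

(** The translation tau moves the n-th point of a sequence in A into B n, which
    minimality permits; the points of the sequence are distinct, so these
    requirements on tau do not conflict. *)
Lemma dense_uncountable_freely_movable (B : nat -> set X) :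
  compact [set: X] -> hausdorff_space X -> (exists x y : X, x <> y) ->
  minimal_flow a -> weakly_mixing a -> (forall n, compact (F n)) ->
  pi_base B ->
  exists A, [/\ ~ countable A, dense A & freely_movable A].
Proof.
move=> cptX sepX X2 mina wma cptF piB; have [oB Bpi] := piB.
have [A ncA fmA] := uncountable_freely_movable cptX sepX X2 wma cptF piB.
have [f finj Af] : exists2 f : nat -> X, injective f & forall n, A (f n).
  have : infinite_set A by move=> /finite_set_countable.
  move=> /infiniteP/card_leP[g].
  pose nT n : [set: nat] := SigSub (mem_set (I : [set: nat] n)).
  exists (fun n => val (g (nT n))) => [m n /val_inj gmn|n]; last exact/set_mem/valP.
  by have /(congr1 val) := inj (f := g) (mem_set I) (mem_set I) gmn.
have /choice[tau tauP] (x : X) : exists t, forall n, f n = x -> B n (a t x).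
  have [[n fn]|nofn] := pselect (exists n, f n = x); last first.
    by exists 0%R => n fn; case: nofn; exists n.
  have [oBn [y By]] := oB n.
  have : closure (range (a ^~ x)) y by rewrite mina.
  move=> /(_ (B n) (open_nbhs_nbhs (conj oBn By)))[_ [[t _ <-] Bt]].
  exists t => m fm; suff -> : m = n by [].
  by apply: finj; rewrite fm.
exists [set a (tau x) x | x in A]; split.
- by rewrite (eq_countable (inj_card_eq (translate_inj (tau := tau) sepX X2 fmA))).
- move=> O O0 oO; have [n BO] := Bpi O oO O0.
  by exists (a (tau (f n)) (f n)); split; [exact/BO/tauP|exists (f n)].
- exact: freely_movable_translate.
Qed.

End FreelyMovable.

(** * The chaotic set *)

Lemma cvg_ptws (R : realType) (X : metricType R) (k : nat)
    (u : nat -> {ptws 'I_k -> X}) (l : {ptws 'I_k -> X}) :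
  (forall n i, ball (l i) n.+1%:R^-1 (u n i)) -> u @ \oo --> l.
Proof.
move=> ul; apply/cvg_sup => i; apply/cvg_image.
  by apply/seteqP; split=> // y _; exists (fun=> y).
move=> C /nbhs_ballP[_/posnumP[e] eC].
exists (@^~ i @^-1` C); last first.
  by apply/seteqP; split=> [_ [g Cg <-]//|y Cy]; exists (fun=> y).
suff : \forall n \near \oo, C (u n i) by [].
near=> n; apply: eC; have en : (n.+1%:R^-1 <= e%:num :> R)%R.
  by apply: ltW; near: n; exact: near_infty_natSinv_lt.
exact: (le_ball en) (ul n i).
Unshelve. all: by end_near. Qed.


Theorem proposition3p9 (R : realType) (T : topologicalZmodType)
    (X : metricType R) (a : flow T X)
    (X_compact : compact [set: X])
    (X_nonsingleton : exists x y : X, x <> y)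
    (a_minimal : minimal_flow a)
    (a_weakly_mixing : weakly_mixing a) :
  densely_multidim_Li_Yorke_chaotic a.
Proof.
move=> F cptF _; have [x0 _] := X_nonsingleton.
have [B piB] := compact_metric_pi_base x0 X_compact.
have [A [ncA dA fmA]] := dense_uncountable_freely_movable X_compact
  (@metric_hausdorff _ X) X_nonsingleton a_minimal a_weakly_mixing cptF piB.
exists A; split=> // k x _ xinj Ax.
have T0 : [set: X] !=set0 by exists x0.
(* One statement for both sequences: the target is l = x for the recurrence and
   the constant tuple x0 for the collapse. *)
have move_near (l : 'I_k -> X) n : exists t, ~ F n t /\
    forall i, ball (l i) n.+1%:R^-1 (a t (x i)).
  pose U y := if [pick i | x i == y] is Some i
    then (ball (l i) n.+1%:R^-1)^° else setT.
  have oU y : open (U y) /\ U y !=set0.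
    rewrite /U; case: pickP => [i _|_]; last by split=> //; exact: openT.
    split; first exact: open_interior.
    by exists (l i); apply: nbhsx_ballx; rewrite invr_gt0 ltr0n.
  have [_ /mapP[i _ ->] //|t [_ Ft Ut]] := fmA [seq x i | i <- enum 'I_k] U
    setT setT n _ oU openT T0 openT T0.
  exists t; split=> // i.
  have := Ut (x i) (map_f x (mem_enum _ i)); rewrite /U.
  case: pickP => [j /eqP /xinj ->|/(_ i)]; last by rewrite eqxx.
  exact: interior_subset.
have [s sP] := choice (move_near x).
have [t tP] := choice (move_near (fun=> x0)).
exists s, t, x0; split=> [n| |]; first by case: (sP n).
  by apply: cvg_ptws => n i; exact: (sP n).2.
by apply: (cvg_ptws (l := fun=> x0)) => n i; exact: (tP n).2.
Qed.
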